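(* Let $s\ge0$ be an integer and suppose $f\in C^s(\mathbb{R}^2)$ has the form $$f(x,y)=\sum_{i=1}^kf_i(a_ix+b_iy),$$ where $(a_i,b_i)$, $i=1,\dots,k$, are pairwise linearly independent vectors in $\mathbb{R}^2$ and $f_i:\mathbb{R}\to\mathbb{R}$ are arbitrary univariate functions. Then there exist functions $g_i\in C^s(\mathbb{R})$, $i=1,\dots,k$, such that $$f(x,y)=\sum_{i=1}^kg_i(a_ix+b_iy)\qquad\text{for all }(x,y)\in\mathbb{R}^2.$$
   Context: $C^s$ denotes $s$ times continuously differentiable real functions, with $C^0=C$. No regularity is assumed on the $f_i$. *)

(* Defs.v *)
From Stdlib Require Import Reals.
From Coquelicot Require Import Coquelicot.
Open Scope R_scope.

Definition Cs_R (s : nat) (g : R -> R) : Prop :=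
  forall n : nat, (n <= s)%nat ->
  forall x : R, ex_derive_n g n x /\ continuous (Derive_n g n) x.

(* [ex_diff_n f s x y] asks that all iterated partial derivatives of [f] of
   order at most [s], in every order of differentiation, be continuous at
   [(x, y)], those of order less than [s] having both partial derivatives
   there. *)
Definition Cs_R2 (s : nat) (f : R -> R -> R) : Prop :=
  forall x y : R, ex_diff_n f s x y.

Definition lin_indep (u v : R * R) : Prop :=
  forall c d : R, plus (scal c u) (scal d v) = zero -> c = 0 /\ d = 0.

(* Main.v *)
(* A sum of [k] ridge functions is killed by the product of the [k] differences
   along the directions v_i orthogonal to (a_i, b_i), and this property no longer
   mentions the f_i. A function [f] of class C^s with this property is a sum of
   C^s ridge functions, by induction on (s, k). For s > 0, the derivative of [f]
   along v_k is of class C^(s-1) and killed by the other k - 1 differences; each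
   ridge function in its decomposition has a primitive along v_k which is again
   a ridge function, and [f] minus these primitives is constant along v_k. For
   s = 0, let m(p) be the integral of f(p + h v_k) over h in [0, 1]: the same
   argument applies to [m], whose derivative along v_k is f(p + v_k) - f(p), and
   m - f, an average of differences of [f], is killed by k - 1 differences. *)
Require Import Defs.
From Stdlib Require Import Reals Lra Lia Classical.
From Coquelicot Require Import Coquelicot.
Open Scope R_scope.

(** * Calculus of C^s functions of one variable *)

Lemma Derive_n_Derive (g : R -> R) (n : nat) (x : R) :
  Derive_n (Derive g) n x = Derive_n g (S n) x.
Proof.
  change (Derive g) with (Derive_n g 1).
  rewrite Derive_n_comp. f_equal. lia.
Qed.

Lemma Cs_R_0 (g : R -> R) : (forall x, continuous g x) -> Cs_R 0 g.
Proof.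
  intros H n Hn x. assert (n = 0%nat) by lia. subst n. split; [exact I | apply H].
Qed.

Lemma Cs_R_continuous (s : nat) (g : R -> R) :
  Cs_R s g -> forall x, continuous g x.
Proof. intros H x. apply (H 0%nat). lia. Qed.

Lemma Cs_R_S (s : nat) (g : R -> R) :
  Cs_R (S s) g <-> (forall x, ex_derive g x) /\ Cs_R s (Derive g).
Proof.
  split.
  - intros H. split.
    + intros x. apply (H 1%nat). lia.
    + intros n Hn x. split.
      * destruct n as [|n]; [exact I|].
        apply ex_derive_ext with (Derive_n g (S n)).
        { intros t. symmetry. apply Derive_n_Derive. }
        apply (H (S (S n))). lia.
      * apply continuous_ext with (Derive_n g (S n)).
        { intros t. symmetry. apply Derive_n_Derive. }
        apply (H (S n)). lia.
  - intros [H1 H2] n Hn x. destruct n as [|n].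
    + split; [exact I|]. apply (ex_derive_continuous g). apply H1.
    + split.
      * destruct n as [|n]; [apply H1|].
        apply ex_derive_ext with (Derive_n (Derive g) n).
        { intros t. apply Derive_n_Derive. }
        apply (H2 (S n)). lia.
      * apply continuous_ext with (Derive_n (Derive g) n).
        { intros t. apply Derive_n_Derive. }
        apply (H2 n). lia.
Qed.

Lemma Cs_R_ext (s : nat) (g h : R -> R) :
  (forall x, g x = h x) -> Cs_R s g -> Cs_R s h.
Proof.
  revert g h. induction s as [|s IH]; intros g h E H.
  - apply Cs_R_0. intros x. apply continuous_ext with g; [exact E|].
    now apply (Cs_R_continuous 0).
  - apply Cs_R_S in H as [H1 H2]. apply Cs_R_S. split.
    + intros x. now apply ex_derive_ext with g.
    + apply (IH (Derive g)); [|exact H2]. intros x. now apply Derive_ext.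
Qed.

Lemma Cs_R_is_derive (s : nat) (g G : R -> R) :
  (forall x, is_derive g x (G x)) -> Cs_R s G -> Cs_R (S s) g.
Proof.
  intros H HG. apply Cs_R_S. split.
  - intros x. now exists (G x).
  - apply Cs_R_ext with G; [|exact HG]. intros x. symmetry.
    now apply is_derive_unique.
Qed.

Lemma Cs_R_const (s : nat) (c : R) : Cs_R s (fun _ => c).
Proof.
  revert c. induction s as [|s IH]; intros c.
  - apply Cs_R_0. intros x. apply continuous_const.
  - apply Cs_R_is_derive with (fun _ => 0); [|apply IH].
    intros x. apply (is_derive_const c).
Qed.

Lemma Cs_R_lin (s : nat) (g h : R -> R) (c d : R) :
  Cs_R s g -> Cs_R s h -> Cs_R s (fun x => c * g x + d * h x).
Proof.
  revert g h. induction s as [|s IH]; intros g h Hg Hh.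
  - apply Cs_R_0. intros x.
    apply (continuous_plus (fun x => c * g x) (fun x => d * h x)).
    + apply (continuous_scal_r c g). now apply (Cs_R_continuous 0).
    + apply (continuous_scal_r d h). now apply (Cs_R_continuous 0).
  - apply Cs_R_S in Hg as [Hg Hg']. apply Cs_R_S in Hh as [Hh Hh'].
    apply Cs_R_is_derive with (fun x => c * Derive g x + d * Derive h x); [|auto].
    intros x. apply (is_derive_plus (fun x => c * g x) (fun x => d * h x)).
    + apply (is_derive_scal g). now apply Derive_correct.
    + apply (is_derive_scal h). now apply Derive_correct.
Qed.

Lemma Cs_R_plus (s : nat) (g h : R -> R) :
  Cs_R s g -> Cs_R s h -> Cs_R s (fun x => g x + h x).
Proof.
  intros Hg Hh. apply Cs_R_ext with (fun x => 1 * g x + 1 * h x).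
  - intros x. ring.
  - now apply Cs_R_lin.
Qed.

Lemma Cs_R_comp_scal (s : nat) (g : R -> R) (c : R) :
  Cs_R s g -> Cs_R s (fun x => g (c * x)).
Proof.
  revert g. induction s as [|s IH]; intros g Hg.
  - apply Cs_R_0. intros x. apply (continuous_comp (fun x => c * x) g).
    + apply (continuous_scal_r c (fun x : R => x)). apply continuous_id.
    + now apply (Cs_R_continuous 0).
  - apply Cs_R_S in Hg as [Hg Hg'].
    (* The zero term only gives the derivative the two-term shape of [Cs_R_lin]. *)
    apply Cs_R_is_derive with (fun x => c * Derive g (c * x) + 0 * Derive g (c * x)).
    + intros x. replace (_ + _) with (c * Derive g (c * x)) by ring.
      apply (is_derive_comp g (fun x => c * x)).
      * now apply Derive_correct.
      * auto_derive; [exact I | ring].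
    + apply (Cs_R_lin s (fun x => Derive g (c * x)) (fun x => Derive g (c * x))); auto.
Qed.

Lemma Cs_R_sum (s : nat) (g : nat -> R -> R) (n : nat) :
  (forall i, (1 <= i <= n)%nat -> Cs_R s (g i)) ->
  Cs_R s (fun x => sum_n_m (fun i => g i x) 1 n).
Proof.
  induction n as [|n IH]; intros H.
  - apply Cs_R_ext with (fun _ => 0); [|apply Cs_R_const].
    intros x. now rewrite sum_n_m_zero by lia.
  - apply Cs_R_ext with (fun x => sum_n_m (fun i => g i x) 1 n + g (S n) x).
    + intros x. now rewrite sum_n_Sm by lia.
    + apply Cs_R_plus; [apply IH|]; intros; apply H; lia.
Qed.

Lemma continuous_is_RInt (g : R -> R) (a b : R) :
  (forall x, continuous g x) -> is_RInt g a b (RInt g a b).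
Proof.
  intros H. apply (RInt_correct g). apply (ex_RInt_continuous g). intros; apply H.
Qed.

Lemma is_derive_primitive (g : R -> R) (a x : R) :
  (forall x, continuous g x) -> is_derive (fun t => RInt g a t) x (g x).
Proof.
  intros H. apply (is_derive_RInt g _ a); [|apply H].
  apply filter_forall. intros t. now apply continuous_is_RInt.
Qed.

(** Writing [pred s] lets one statement serve both cases of the later induction. For [s = 0] the
    primitive is even C^1, and the extra order is dropped. *)
Lemma Cs_R_primitive (s : nat) (g : R -> R) :
  Cs_R (pred s) g -> Cs_R s (fun t => RInt g 0 t).
Proof.
  intros H. assert (H' := Cs_R_continuous _ _ H).
  assert (HS : Cs_R (S (pred s)) (fun t => RInt g 0 t)).
  { apply Cs_R_is_derive with g; [|exact H].
    intros x. now apply is_derive_primitive. }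
  intros n Hn. apply HS. lia.
Qed.

(** * C^s functions of two variables and their restrictions to lines *)

Lemma Cs_R2_0 (f : R -> R -> R) :
  (forall x y, continuity_2d_pt f x y) -> Cs_R2 0 f.
Proof. intros H x y. simpl. auto. Qed.

Lemma Cs_R2_continuity (s : nat) (f : R -> R -> R) :
  Cs_R2 s f -> forall x y, continuity_2d_pt f x y.
Proof. intros H x y. specialize (H x y). destruct s; apply H. Qed.

Definition Dx (f : R -> R -> R) (x y : R) := Derive (fun z => f z y) x.
Definition Dy (f : R -> R -> R) (x y : R) := Derive (fun z => f x z) y.

Lemma Cs_R2_S (s : nat) (f : R -> R -> R) :
  Cs_R2 (S s) f <->
  (forall x y, continuity_2d_pt f x y) /\
  (forall x y, ex_derive (fun z => f z y) x) /\
  (forall x y, ex_derive (fun z => f x z) y) /\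
  Cs_R2 s (Dx f) /\ Cs_R2 s (Dy f).
Proof.
  split.
  - intros H. repeat split; intros x y; apply (H x y).
  - intros (H1 & H2 & H3 & H4 & H5) x y. simpl. auto.
Qed.

Lemma Cs_R2_ext (s : nat) (f g : R -> R -> R) :
  (forall x y, f x y = g x y) -> Cs_R2 s f -> Cs_R2 s g.
Proof.
  intros E H x y. apply ex_diff_n_ext_loc with f; [|apply H].
  apply locally_2d_forall. intros; apply E.
Qed.

Lemma Cs_R2_lin (s : nat) (f g : R -> R -> R) (c d : R) :
  Cs_R2 s f -> Cs_R2 s g -> Cs_R2 s (fun x y => c * f x y + d * g x y).
Proof.
  revert f g. induction s as [|s IH]; intros f g Hf Hg.
  - apply Cs_R2_0. intros x y.
    apply continuity_2d_pt_plus; apply continuity_2d_pt_mult;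
      try apply continuity_2d_pt_const; now apply (Cs_R2_continuity 0).
  - assert (cf := Cs_R2_continuity _ _ Hf). assert (cg := Cs_R2_continuity _ _ Hg).
    apply Cs_R2_S in Hf as (_ & f2 & f3 & f4 & f5).
    apply Cs_R2_S in Hg as (_ & g2 & g3 & g4 & g5).
    assert (E : forall (u v : R -> R) (t : R), ex_derive u t -> ex_derive v t ->
      is_derive (fun z => c * u z + d * v z) t (c * Derive u t + d * Derive v t)).
    { intros u v t Hu Hv.
      apply (is_derive_plus (fun z => c * u z) (fun z => d * v z));
        apply is_derive_scal; now apply Derive_correct. }
    apply Cs_R2_S. repeat split.
    + intros x y. apply continuity_2d_pt_plus; apply continuity_2d_pt_mult;
      try apply continuity_2d_pt_const; auto.
    + intros x y. eexists. apply (E (fun z => f z y) (fun z => g z y)); auto.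
    + intros x y. eexists. apply (E (fun z => f x z) (fun z => g x z)); auto.
    + apply Cs_R2_ext with (fun x y => c * Dx f x y + d * Dx g x y); [|auto].
      intros x y. symmetry. apply is_derive_unique.
      apply (E (fun z => f z y) (fun z => g z y)); auto.
    + apply Cs_R2_ext with (fun x y => c * Dy f x y + d * Dy g x y); [|auto].
      intros x y. symmetry. apply is_derive_unique.
      apply (E (fun z => f x z) (fun z => g x z)); auto.
Qed.

(** This is the chain rule. Differentiability of [f] at the point comes from the existence of both
    partial derivatives and the continuity of [Dx f]. *)
Lemma Cs_R2_is_derive_line (s : nat) (f : R -> R -> R) (x y p q h : R) :
  Cs_R2 (S s) f ->
  is_derive (fun h => f (x + h * p) (y + h * q)) h
    (p * Dx f (x + h * p) (y + h * q) + q * Dy f (x + h * p) (y + h * q)).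
Proof.
  intros H. apply Cs_R2_S in H as (_ & H2 & H3 & H4 & _).
  rewrite (Rmult_comm p), (Rmult_comm q).
  apply is_derive_Reals. apply derivable_pt_lim_comp_2d.
  - apply filterdiff_differentiable_pt_lim.
    apply is_derive_filterdiff with (dfx := Dx f).
    + apply filter_forall. intros u. apply Derive_correct. apply H2.
    + apply Derive_correct. apply H3.
    + apply (proj1 (continuity_2d_pt_filterlim (Dx f) _ _)).
      now apply (Cs_R2_continuity s).
  - apply is_derive_Reals. auto_derive; [exact I | ring].
  - apply is_derive_Reals. auto_derive; [exact I | ring].
Qed.

Lemma continuous_line (f : R -> R -> R) (x y p q h : R) :
  (forall x y, continuity_2d_pt f x y) ->
  continuous (fun h => f (x + h * p) (y + h * q)) h.
Proof.
  intros H.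
  apply (continuous_comp_2 (fun h => x + h * p) (fun h => y + h * q) f).
  - apply (ex_derive_continuous (fun h => x + h * p)). now auto_derive.
  - apply (ex_derive_continuous (fun h => y + h * q)). now auto_derive.
  - apply (proj1 (continuity_2d_pt_filterlim f _ _)). apply H.
Qed.

Lemma Cs_R2_line (s : nat) (f : R -> R -> R) (x y p q : R) :
  Cs_R2 s f -> Cs_R s (fun h => f (x + h * p) (y + h * q)).
Proof.
  revert f. induction s as [|s IH]; intros f H.
  - apply Cs_R_0. intros h. apply continuous_line. now apply (Cs_R2_continuity 0).
  - apply Cs_R_is_derive with (fun h =>
      p * Dx f (x + h * p) (y + h * q) + q * Dy f (x + h * p) (y + h * q)).
    + intros h. now apply (Cs_R2_is_derive_line s f).
    + apply Cs_R2_S in H as (_ & _ & _ & H4 & H5).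
      apply (Cs_R_lin s (fun h => Dx f (x + h * p) (y + h * q))
               (fun h => Dy f (x + h * p) (y + h * q))); auto.
Qed.

(** * Iterated differences and the ridge sums they annihilate *)

(* The differences are taken along [(- b i, a i)], the direction in which
   functions of [a i * x + b i * y] are constant. *)
Fixpoint annihilated (a b : nat -> R) (k : nat) (f : R -> R -> R) : Prop :=
  match k with
  | 0%nat => forall x y, f x y = 0
  | S n => forall h,
      annihilated a b n (fun x y => f (x + h * - b k) (y + h * a k) - f x y)
  end.

Lemma annihilated_ext (a b : nat -> R) (k : nat) (f g : R -> R -> R) :
  (forall x y, f x y = g x y) -> annihilated a b k f -> annihilated a b k g.
Proof.
  revert f g. induction k as [|k IH]; intros f g E H.
  - intros x y. rewrite <- E. apply H.
  - intros h. refine (IH _ _ _ (H h)). intros x y. simpl. now rewrite !E.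
Qed.

(** The outermost difference cancels the last summand and turns each other one into a ridge function
    of the same direction, with profile [g i (t + h * c) - g i t] for a constant [c], so induction
    applies to the new profiles. *)
Lemma annihilated_ridge_sum (a b : nat -> R) (k : nat) (g : nat -> R -> R) :
  annihilated a b k (fun x y => sum_n_m (fun i => g i (a i * x + b i * y)) 1 k).
Proof.
  revert g. induction k as [|k IH]; intros g.
  - intros x y. now rewrite sum_n_m_zero by lia.
  - intros h.
    apply annihilated_ext with (fun x y => sum_n_m (fun i =>
       (fun t => g i (t + h * (b i * a (S k) - a i * b (S k))) - g i t)
         (a i * x + b i * y)) 1 k).
    2: apply (IH (fun i t => g i (t + h * (b i * a (S k) - a i * b (S k))) - g i t)).
    intros x y. rewrite !sum_n_Sm by lia. unfold plus; simpl.
    set (u := sum_n_m _ 1 k) at 1. set (v := sum_n_m _ 1 k). set (w := sum_n_m _ 1 k).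
    (* Here [v] and [w] are the sums at the translated point and at [(x, y)], and [u] is the sum of
       the differenced profiles. *)
    assert (E : u + w = v).
    { unfold u, v, w. rewrite <- (sum_n_m_plus (G := R_AbelianMonoid)).
      apply sum_n_m_ext. intros i. unfold plus; simpl.
      rewrite Rplus_comm, Rplus_minus. f_equal. ring. }
    rewrite <- E. change (AbelianMonoid.sort R_AbelianMonoid) with R in *.
    replace (a (S k) * (x + h * - b (S k)) + b (S k) * (y + h * a (S k)))
      with (a (S k) * x + b (S k) * y) by ring.
    ring.
Qed.

(** Differences in [(x, y)] are linear, so they commute with differentiation in the parameter, and
    the derivative of the zero function is zero. *)
Lemma annihilated_is_derive (a b : nat -> R) (k : nat) (f : R -> R -> R -> R) (F : R -> R -> R) (t : R) :
  (forall x y, is_derive (fun h => f h x y) t (F x y)) ->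
  (forall h, annihilated a b k (f h)) -> annihilated a b k F.
Proof.
  revert f F. induction k as [|k IH]; intros f F HF H.
  - intros x y. rewrite <- (is_derive_unique _ _ _ (HF x y)).
    rewrite (Derive_ext _ (fun _ => 0)); [apply Derive_const|].
    intros h. apply H.
  - intros h. refine (IH _ _ _ (fun u => H u h)). intros x y.
    now apply (is_derive_minus (fun u => f u (x + h * - b (S k)) (y + h * a (S k)))
             (fun u => f u x y)).
Qed.

(** Differences commute with integration in the parameter for the same reason. *)
Lemma annihilated_is_RInt (a b : nat -> R) (k : nat) (f : R -> R -> R -> R) (F : R -> R -> R) (c d : R) :
  (forall x y, is_RInt (fun h => f h x y) c d (F x y)) ->
  (forall h, annihilated a b k (f h)) -> annihilated a b k F.
Proof.
  revert f F. induction k as [|k IH]; intros f F HF H.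
  - intros x y. rewrite <- (is_RInt_unique _ _ _ _ (HF x y)).
    rewrite (RInt_ext _ (fun _ => 0)).
    + rewrite RInt_const. apply Rmult_0_r.
    + intros h _. apply H.
  - intros h. refine (IH _ _ _ (fun u => H u h)). intros x y.
    now apply (is_RInt_minus (fun u => f u (x + h * - b (S k)) (y + h * a (S k)))
             (fun u => f u x y)).
Qed.

(** * Integration of ridge sums along one direction *)

Lemma is_derive_sum_n_m (f : nat -> R -> R) (d : nat -> R) (n : nat) (x : R) :
  (forall i, (1 <= i <= n)%nat -> is_derive (f i) x (d i)) ->
  is_derive (fun t => sum_n_m (fun i => f i t) 1 n) x (sum_n_m d 1 n).
Proof.
  induction n as [|n IH]; intros H.
  - rewrite sum_n_m_zero by lia.
    apply is_derive_ext with (fun _ => 0); [|apply (is_derive_const 0)].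
    intros t. now rewrite sum_n_m_zero by lia.
  - rewrite sum_n_Sm by lia.
    apply is_derive_ext with (fun t => plus (sum_n_m (fun i => f i t) 1 n) (f (S n) t)).
    { intros t. now rewrite sum_n_Sm by lia. }
    apply (is_derive_plus (fun t => sum_n_m (fun i => f i t) 1 n) (f (S n))).
    + apply IH. intros; apply H; lia.
    + apply H; lia.
Qed.

Lemma is_derive_zero_constant (g : R -> R) :
  (forall t, is_derive g t 0) -> forall u v, g u = g v.
Proof.
  intros H u v. destruct (Rtotal_order u v) as [L | [-> | L]].
  - apply (eq_is_derive g); auto.
  - reflexivity.
  - symmetry. apply (eq_is_derive g); auto.
Qed.

Definition ridge_sum_Cs (a b : nat -> R) (s k : nat) (f : R -> R -> R) : Prop :=
  exists g : nat -> R -> R,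
    (forall i : nat, (1 <= i <= k)%nat -> Cs_R s (g i)) /\
    (forall x y : R,
       f x y = sum_n_m (fun i : nat => g i (a i * x + b i * y)) 1 k).

(* Integrating the [i]-th summand of [F] gives a ridge function with the same
   derivative along [(- b (S k), a (S k))], and what remains of [f] is constant
   along this vector. *)
Lemma ridge_sum_Cs_integrate (a b : nat -> R) (s k : nat) (f F : R -> R -> R) :
  Cs_R2 s f ->
  (a (S k) <> 0 \/ b (S k) <> 0) ->
  (forall i, (1 <= i <= k)%nat -> b i * a (S k) - a i * b (S k) <> 0) ->
  (forall x y h, is_derive (fun h => f (x + h * - b (S k)) (y + h * a (S k))) h
     (F (x + h * - b (S k)) (y + h * a (S k)))) ->
  ridge_sum_Cs a b (pred s) k F ->
  ridge_sum_Cs a b s (S k) f.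
Proof.
  intros Cf Hn Hd HF [G [CG EG]].
  set (al := a (S k)) in *. set (be := b (S k)) in *.
  set (N := al * al + be * be).
  assert (HN : N <> 0) by (unfold N; nra).
  (* [c i] is the rate of change of [a i * x + b i * y] along [(- be, al)]. Dividing a primitive of
     [G i] by it makes the derivative of the ridge function along that vector equal to [G i]. *)
  set (c := fun i => b i * al - a i * be) in *.
  set (g := fun i t => / c i * RInt (G i) 0 t).
  set (r := fun x y => f x y - sum_n_m (fun i => g i (a i * x + b i * y)) 1 k).
  assert (Cg : forall i, (1 <= i <= k)%nat -> Cs_R s (g i)).
  { intros i Hi. apply Cs_R_ext with
      (fun t => / c i * RInt (G i) 0 t + 0 * RInt (G i) 0 t).
    - intros t. unfold g. ring.
    - apply (Cs_R_lin s (fun t => RInt (G i) 0 t) (fun t => RInt (G i) 0 t));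
        apply Cs_R_primitive; auto. }
  (* Along [(- be, al)] the derivative of [f] is [F] and that of the subtracted sum is the sum of
     the [G i]; they agree by [EG]. *)
  assert (Hr : forall x y h, r (x + h * - be) (y + h * al) = r x y).
  { intros x y h.
    transitivity (r (x + 0 * - be) (y + 0 * al)).
    2: f_equal; ring.
    apply (is_derive_zero_constant (fun h => r (x + h * - be) (y + h * al))).
    clear h. intros h.
    evar_last.
    { apply (is_derive_minus (fun h => f (x + h * - be) (y + h * al))
        (fun h => sum_n_m (fun i =>
           g i (a i * (x + h * - be) + b i * (y + h * al))) 1 k)).
      - apply HF.
      - apply (is_derive_sum_n_m
          (fun i h => g i (a i * (x + h * - be) + b i * (y + h * al)))
          (fun i => G i (a i * (x + h * - be) + b i * (y + h * al)))).
        intros i Hi.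
        evar_last.
        { apply (is_derive_comp (g i)
            (fun h => a i * (x + h * - be) + b i * (y + h * al)) h
            (/ c i * G i (a i * (x + h * - be) + b i * (y + h * al))) (c i)).
          - apply (is_derive_scal (fun t => RInt (G i) 0 t)).
            apply is_derive_primitive.
            apply (Cs_R_continuous (pred s)). auto.
          - unfold c. auto_derive; [exact I | ring]. }
        unfold scal; simpl; unfold mult; simpl. field. now apply Hd. }
    rewrite EG. apply (minus_eq_zero (G := R_AbelianGroup)). }
  (* Moving along [(- be, al)] by [(be * x - al * y) / N] takes [(x, y)] to its orthogonal
     projection on the line spanned by [(al, be)]. Hence [r] is a ridge function with profile
     [rho]. *)
  assert (Er : forall x y, r x y =
    r (0 + (al * x + be * y) * (al / N)) (0 + (al * x + be * y) * (be / N))).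
  { intros x y. rewrite <- (Hr x y ((be * x - al * y) / N)).
    f_equal; unfold N; field; exact HN. }
  set (rho := fun t => r (0 + t * (al / N)) (0 + t * (be / N))).
  exists (fun i => if Nat.eqb i (S k) then rho else g i). split.
  - intros i Hi. destruct (Nat.eqb_spec i (S k)) as [E | E].
    2: apply Cg; lia.
    (* On that line [f] is C^s by restriction, and each summand is [g i] at a fixed multiple of
       [t]. *)
    apply Cs_R_ext with (fun t => 1 * f (0 + t * (al / N)) (0 + t * (be / N)) +
       (-1) * sum_n_m (fun i => g i ((a i * (al / N) + b i * (be / N)) * t)) 1 k).
    + intros t. unfold rho, r. rewrite Rmult_1_l.
      replace (sum_n_m (fun i => g i ((a i * (al / N) + b i * (be / N)) * t)) 1 k)
        with (sum_n_m (fun i => g i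
          (a i * (0 + t * (al / N)) + b i * (0 + t * (be / N)))) 1 k).
      * ring.
      * apply sum_n_m_ext. intros j. f_equal. ring.
    + apply (Cs_R_lin s (fun t => f (0 + t * (al / N)) (0 + t * (be / N)))).
      * now apply Cs_R2_line.
      * apply (Cs_R_sum s (fun i t => g i ((a i * (al / N) + b i * (be / N)) * t))).
        intros j Hj. apply Cs_R_comp_scal. auto.
  - intros x y. rewrite sum_n_Sm by lia. rewrite Nat.eqb_refl.
    rewrite (sum_n_m_ext_loc _ (fun i => g i (a i * x + b i * y))).
    + unfold rho. fold al be. rewrite <- Er. unfold r, plus; simpl. ring.
    + intros i Hi. destruct (Nat.eqb_spec i (S k)); [lia | reflexivity].
Qed.

(** * Translates and averages along a fixed vector *)

Lemma continuity_2d_pt_translate (f : R -> R -> R) (u v : R) :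
  (forall x y, continuity_2d_pt f x y) ->
  forall x y, continuity_2d_pt (fun x y => f (x + u) (y + v)) x y.
Proof.
  intros H x y eps. destruct (H (x + u) (y + v) eps) as [d Hd]. exists d.
  intros x' y' Hx Hy. apply Hd.
  - now replace (x' + u - (x + u)) with (x' - x) by ring.
  - now replace (y' + v - (y + v)) with (y' - y) by ring.
Qed.

Definition line_average (f : R -> R -> R) (p q x y : R) : R :=
  RInt (fun h => f (x + h * p) (y + h * q)) 0 1.

(** Uniform continuity of [f] on a rectangle bounds the change of the integrand simultaneously for
    all [h] in [0, 1]. *)
Lemma continuity_2d_line_average (f : R -> R -> R) (p q : R) :
  (forall x y, continuity_2d_pt f x y) ->
  forall x y, continuity_2d_pt (line_average f p q) x y.
Proof.
  intros H x y eps.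
  (* The bound on the integral is not strict; halving [eps] restores strictness. *)
  assert (Heps : 0 < eps / 2) by (destruct eps; simpl; lra).
  (* The rectangle contains every segment that starts within distance 1 of [(x, y)] in each
     coordinate, whence the minimum with 1 below. *)
  set (P := Rabs p + 1). set (Q := Rabs q + 1).
  destruct (uniform_continuity_2d f (x - P) (x + P) (y - Q) (y + Q)
     (fun x y _ _ => H x y) (mkposreal _ Heps)) as [d Hd].
  assert (Hd1 : 0 < Rmin d 1) by (apply Rmin_pos; [apply d | lra]).
  exists (mkposreal _ Hd1). simpl. intros u v Hu Hv.
  assert (Hd' := Rmin_l d 1). assert (H1 := Rmin_r d 1).
  assert (Hint : forall x y, is_RInt (fun h => f (x + h * p) (y + h * q)) 0 1
      (line_average f p q x y)).
  { intros x0 y0. apply (continuous_is_RInt (fun h => f (x0 + h * p) (y0 + h * q))).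
    intros h. now apply continuous_line. }
  assert (B := norm_RInt_le_const
    (fun h => minus (f (u + h * p) (v + h * q)) (f (x + h * p) (y + h * q))) 0 1
    (minus (line_average f p q u v) (line_average f p q x y)) (eps / 2)).
  apply Rle_lt_trans with ((1 - 0) * (eps / 2)).
  2: destruct eps; simpl; lra.
  apply B; [lra | | now apply (is_RInt_minus (fun h => f (u + h * p) (v + h * q)))].
  intros h Hh. apply Rlt_le.
  assert (Bh : forall c, Rabs (h * c) <= Rabs c).
  { intros c. rewrite Rabs_mult. rewrite (Rabs_pos_eq h) by lra.
    assert (C := Rabs_pos c). nra. }
  assert (Bp := Bh p). assert (Bq := Bh q).
  apply Rabs_le_between in Bp. apply Rabs_le_between in Bq.
  assert (Hu' := Hu). assert (Hv' := Hv).
  apply Rabs_lt_between in Hu'. apply Rabs_lt_between in Hv'.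
  apply Hd; unfold P, Q; try lra.
  - replace (u + h * p - (x + h * p)) with (u - x) by ring. lra.
  - replace (v + h * q - (y + h * q)) with (v - y) by ring. lra.
Qed.

(** Along the line the average is the integral of [phi] over [t, t + 1], a difference of two
    primitives. The factors [1 *] in the translate match the difference with [h = 1] in
    [annihilated]. *)
Lemma is_derive_line_average (f : R -> R -> R) (p q x y h : R) :
  (forall x y, continuity_2d_pt f x y) ->
  is_derive (fun h => line_average f p q (x + h * p) (y + h * q)) h
    (f (x + h * p + 1 * p) (y + h * q + 1 * q) - f (x + h * p) (y + h * q)).
Proof.
  intros H. set (phi := fun t => f (x + t * p) (y + t * q)).
  assert (Cphi : forall t, continuous phi t).
  { intros t. now apply continuous_line. }
  assert (E : forall t, line_average f p q (x + t * p) (y + t * q) =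
     RInt phi 0 (1 * t + 1) - RInt phi 0 t).
  { intros t. unfold line_average.
    rewrite (RInt_ext _ (fun u => scal 1 (phi (1 * u + t)))).
    2:{ intros u _. unfold phi, scal; simpl; unfold mult; simpl.
        rewrite Rmult_1_l. f_equal; ring. }
    etransitivity.
    { apply (RInt_comp_lin phi 1 t 0 1). now apply (ex_RInt_continuous phi). }
    rewrite <- (RInt_Chasles phi 0 t (1 * t + 1));
      try now apply (ex_RInt_continuous phi).
    replace (1 * 0 + t) with t by ring. replace (1 * 1 + t) with (1 * t + 1) by ring.
    symmetry. apply Rplus_minus_l. }
  apply is_derive_ext with (fun t => RInt phi 0 (1 * t + 1) - RInt phi 0 t).
  { intros t. now rewrite E. }
  evar_last.
  { apply (is_derive_minus (fun t => RInt phi 0 (1 * t + 1)) (fun t => RInt phi 0 t)).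
    - apply (is_derive_comp (fun t => RInt phi 0 t) (fun t => 1 * t + 1) h
        (phi (1 * h + 1)) 1).
      + now apply is_derive_primitive.
      + auto_derive; [exact I | ring].
    - now apply is_derive_primitive. }
  unfold minus, plus, opp, scal; simpl; unfold mult; simpl.
  unfold phi. rewrite Rmult_1_l. unfold Rminus. f_equal. f_equal; ring.
Qed.

(** * The induction on smoothness and number of directions, and the theorem *)

(** The outer induction on [s] keeps [k] general, since differentiating lowers both. The case
    [s = 0] needs an inner induction on [k], in which averaging preserves continuity. *)
Lemma ridge_sum_Cs_annihilated (a b : nat -> R) (s k : nat) (f : R -> R -> R) :
  (forall i, (1 <= i <= k)%nat -> a i <> 0 \/ b i <> 0) ->
  (forall i j, (1 <= i <= k)%nat -> (1 <= j <= k)%nat -> i <> j ->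
     b i * a j - a i * b j <> 0) ->
  Cs_R2 s f -> annihilated a b k f -> ridge_sum_Cs a b s k f.
Proof.
  revert k f. induction s as [|s IHs].
  - induction k as [|k IHk]; intros f Hn Hd Cf Hf.
    { exists (fun _ _ => 0). split; [lia|]. intros x y.
      rewrite sum_n_m_zero by lia. apply Hf. }
    assert (Hn' : forall i, (1 <= i <= k)%nat -> a i <> 0 \/ b i <> 0)
      by (intros; apply Hn; lia).
    assert (Hd' : forall i j, (1 <= i <= k)%nat -> (1 <= j <= k)%nat -> i <> j ->
      b i * a j - a i * b j <> 0) by (intros; apply Hd; lia).
    assert (cf := Cs_R2_continuity 0 f Cf).
    set (m := line_average f (- b (S k)) (a (S k))).
    assert (cm : forall x y, continuity_2d_pt m x y)
      by now apply continuity_2d_line_average.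
    destruct (IHk (fun x y => m x y - f x y)) as [g [Cg Eg]]; auto.
    { apply Cs_R2_0. intros x y. apply continuity_2d_pt_minus; auto. }
    (* [m - f] is the integral over [h] in [0, 1] of the differences of [f] by [h], each annihilated
       by the first [k] directions. *)
    { apply (annihilated_is_RInt a b k (fun h x y =>
        f (x + h * - b (S k)) (y + h * a (S k)) - f x y) _ 0 1); [|exact Hf].
      intros x y.
      replace (m x y - f x y) with (minus (m x y) (scal (1 - 0) (f x y)))
        by (unfold minus, plus, opp, scal; simpl; unfold mult; simpl; ring).
      apply (is_RInt_minus (fun h => f (x + h * - b (S k)) (y + h * a (S k)))
        (fun _ => f x y)).
      - apply (continuous_is_RInt (fun h => f (x + h * - b (S k)) (y + h * a (S k)))).
        intros h. now apply continuous_line.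
      - apply (is_RInt_const (V := R_NormedModule)). }
    (* The derivative of [m] is the difference of [f] with [h = 1], to which [IHk] applies;
       [pred 0 = 0] is the right class for its profiles. *)
    destruct (ridge_sum_Cs_integrate a b 0 k m (fun x y =>
      f (x + 1 * - b (S k)) (y + 1 * a (S k)) - f x y)) as [g' [Cg' Eg']].
    { now apply Cs_R2_0. }
    { apply Hn; lia. }
    { intros i Hi. apply Hd; lia. }
    { intros x y h. now apply is_derive_line_average. }
    { apply IHk; auto. apply Cs_R2_0. intros x y.
      apply continuity_2d_pt_minus; auto.
      now apply (continuity_2d_pt_translate f). }
    (* [f = m - (m - f)], where the second term has no summand of index [S k]. *)
    exists (fun i t => if Nat.eqb i (S k) then g' i t else 1 * g' i t + -1 * g i t).
    split.
    + intros i Hi. destruct (Nat.eqb_spec i (S k)) as [E | E].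
      * apply Cs_R_ext with (g' i); auto.
      * apply Cs_R_lin; [apply Cg' | apply Cg]; lia.
    + intros x y. rewrite sum_n_Sm by lia. rewrite Nat.eqb_refl.
      rewrite (sum_n_m_ext_loc _ (fun i => plus (g' i (a i * x + b i * y))
         (mult (-1) (g i (a i * x + b i * y))))).
      2:{ intros i Hi. destruct (Nat.eqb_spec i (S k)); [lia|].
          unfold plus, mult; simpl. ring. }
      rewrite (sum_n_m_plus (G := R_AbelianMonoid)), (sum_n_m_mult_l (K := R_Ring)).
      rewrite <- Eg. specialize (Eg' x y). rewrite sum_n_Sm in Eg' by lia.
      unfold plus, mult in *; simpl in *. lra.
  - intros [|k] f Hn Hd Cf Hf.
    { exists (fun _ _ => 0). split; [lia|]. intros x y.
      rewrite sum_n_m_zero by lia. apply Hf. }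
    set (F := fun x y => - b (S k) * Dx f x y + a (S k) * Dy f x y).
    assert (HF : forall x y h, is_derive (fun h =>
      f (x + h * - b (S k)) (y + h * a (S k))) h
      (F (x + h * - b (S k)) (y + h * a (S k)))).
    { intros x y h. now apply (Cs_R2_is_derive_line s). }
    apply ridge_sum_Cs_integrate with F; auto.
    + apply Hn; lia.
    + intros i Hi. apply Hd; lia.
    + apply IHs.
      * intros; apply Hn; lia.
      * intros; apply Hd; lia.
      * apply Cs_R2_S in Cf as (_ & _ & _ & C1 & C2). now apply Cs_R2_lin.
      (* [F] is the derivative at [h = 0] of the differences of [f] by [h]. *)
      * apply (annihilated_is_derive a b k (fun h x y =>
          f (x + h * - b (S k)) (y + h * a (S k)) - f x y) F 0); [|exact Hf].
        intros x y. evar_last.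
        { apply (is_derive_minus (fun h => f (x + h * - b (S k)) (y + h * a (S k)))
            (fun _ => f x y)).
          - apply HF.
          - apply (is_derive_const (f x y)). }
        rewrite !Rmult_0_l, !Rplus_0_r. apply (minus_zero_r (G := R_AbelianGroup)).
Qed.

(** If the determinant vanishes, the coefficients [(c, - a)] and [(d, - b)] both give linear
    relations, so all four entries are zero, and then [(1, 0)] is a nontrivial relation. *)
Lemma lin_indep_det (u v : R * R) :
  lin_indep u v -> snd u * fst v - fst u * snd v <> 0.
Proof.
  intros H E. destruct u as [a b], v as [c d]; simpl in E.
  assert (K : forall l m, l * a + m * c = 0 -> l * b + m * d = 0 -> l = 0 /\ m = 0).
  { intros l m E1 E2. apply H. apply (f_equal2 pair); assumption. }
  destruct (K c (- a)) as [Hc Ha]; [ring | lra |].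
  destruct (K d (- b)) as [Hd Hb]; [lra | ring |].
  destruct (K 1 0) as [H1 _]; [nra | nra | lra].
Qed.

Theorem theorem2p6 (s k : nat) (f : R -> R -> R) (a b : nat -> R)
  (fi : nat -> R -> R)
  (hf : Cs_R2 s f)
  (hab : forall i j : nat, (1 <= i <= k)%nat -> (1 <= j <= k)%nat -> i <> j ->
     lin_indep (a i, b i) (a j, b j))
  (hsum : forall x y : R,
     f x y = sum_n_m (fun i : nat => fi i (a i * x + b i * y)) 1 k) :
  exists g : nat -> R -> R,
    (forall i : nat, (1 <= i <= k)%nat -> Cs_R s (g i)) /\
    (forall x y : R,
       f x y = sum_n_m (fun i : nat => g i (a i * x + b i * y)) 1 k).
Proof.
  assert (Hd : forall i j, (1 <= i <= k)%nat -> (1 <= j <= k)%nat -> i <> j ->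
     b i * a j - a i * b j <> 0).
  { intros i j Hi Hj Hij. exact (lin_indep_det _ _ (hab i j Hi Hj Hij)). }
  (* For [k = 1], independence is void and [(a 1, b 1)] may vanish. *)
  destruct (classic (k = 1%nat /\ a 1%nat = 0 /\ b 1%nat = 0)) as [[-> [Ha Hb]] | Hk].
  - exists (fun _ _ => f 0 0). split.
    + intros i _. apply Cs_R_const.
    + intros x y. rewrite sum_n_n, !hsum, !sum_n_n, Ha, Hb. f_equal. ring.
  - apply ridge_sum_Cs_annihilated; auto.
    + intros i Hi. destruct (Req_dec (a i) 0) as [Ha|]; [|now left].
      destruct (Req_dec (b i) 0) as [Hb|]; [|now right].
      exfalso. destruct (Nat.eq_dec k 1) as [Hk1 | Hk1].
      * apply Hk. assert (i = 1%nat) by lia. subst i. auto.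
      (* Now [k] is at least 2, so an index [j] other than [i] exists, and a zero vector would have
         zero determinant with the [j]-th one. *)
      * set (j := if Nat.eqb i 1 then 2%nat else 1%nat).
        apply (Hd i j Hi); unfold j; destruct (Nat.eqb_spec i 1); try lia;
          rewrite Ha, Hb; ring.
    + apply annihilated_ext with (fun x y =>
        sum_n_m (fun i => fi i (a i * x + b i * y)) 1 k).
      * intros x y. now rewrite hsum.
      * apply annihilated_ridge_sum.
Qed.
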